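(* Let $K$ be a finite polyhedral complex in $\mathbb{R}^n$, in which some cells may be unbounded. Then $K$ is homotopy equivalent to a bounded polyhedral complex having no more cells than $K$ has.
   Context: A polyhedral complex in $\mathbb{R}^n$ is a finite collection of closed convex polyhedra (cells), closed under taking faces, such that any two cells intersect in a common face (possibly empty); it is identified with the union of its cells. *)

(* Defs.v *)
From HB Require Import structures.
From mathcomp Require Import all_boot all_order all_algebra.
From mathcomp Require Import all_classical all_reals all_analysis.
Set Implicit Arguments. Unset Strict Implicit. Unset Printing Implicit Defensive.
Import Order.TTheory GRing.Theory Num.Theory.
Import numFieldNormedType.Exports.
Local Open Scope classical_set_scope.
Local Open Scope ring_scope.

Definition dotv {R : realType} {n : nat} (u v : 'rV[R]_n) : R := (u *m v^T) 0 0.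

Definition polyhedron {R : realType} {n : nat} (P : set 'rV[R]_n) : Prop :=
  exists s : seq ('rV[R]_n * R),
    P = [set x | forall h, h \in s -> dotv h.1 x <= h.2].

(* F is a face of the polyhedron P: F = P ∩ {<a,x> = c} for a valid inequality
   <a,x> <= c of P (a = 0, c = 0 gives P itself; a = 0, c = 1 gives the
   empty face) *)
Definition face {R : realType} {n : nat} (F P : set 'rV[R]_n) : Prop :=
  polyhedron P /\
  exists (a : 'rV[R]_n) (c : R),
    (forall x, P x -> dotv a x <= c) /\ F = P `&` [set x | dotv a x = c].

Definition polyhedral_complex {R : realType} {n : nat}
    (K : seq (set 'rV[R]_n)) : Prop :=
  [/\ uniq K,
      (forall C, C \in K -> polyhedron C),
      (forall C F, C \in K -> face F C -> F \in K) &
      (forall C D, C \in K -> D \in K -> face (C `&` D) C /\ face (C `&` D) D)].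

Definition ncells {R : realType} {n : nat} (K : seq (set 'rV[R]_n)) : nat :=
  size K.

Definition bounded_complex {R : realType} {n : nat}
    (K : seq (set 'rV[R]_n)) : Prop :=
  forall C, C \in K -> [bounded x | x in C].

Definition underlying_space {R : realType} {n : nat} (K : seq (set 'rV[R]_n))
    : set 'rV[R]_n :=
  [set x | exists2 C, C \in K & C x].

(* f is a continuous map from the subspace A of R^n to the subspace B of R^m
   (represented by a total function; only its values on A matter) *)
Definition cont_map {R : realType} {n m : nat}
    (A : set 'rV[R]_n) (B : set 'rV[R]_m) (f : 'rV[R]_n -> 'rV[R]_m) : Prop :=
  {within A, continuous f} /\ (forall x, A x -> B (f x)).

Definition homotopic {R : realType} {n m : nat}
    (A : set 'rV[R]_n) (B : set 'rV[R]_m) (f g : 'rV[R]_n -> 'rV[R]_m) : Prop :=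
  exists H : R * 'rV[R]_n -> 'rV[R]_m,
    [/\ {within `[0, 1]%classic `*` A, continuous H},
        (forall t x, `[0, 1]%classic t -> A x -> B (H (t, x))),
        (forall x, A x -> H (0, x) = f x) &
        (forall x, A x -> H (1, x) = g x)].

Definition homotopy_equivalent {R : realType} {n m : nat}
    (A : set 'rV[R]_n) (B : set 'rV[R]_m) : Prop :=
  exists (f : 'rV[R]_n -> 'rV[R]_m) (g : 'rV[R]_m -> 'rV[R]_n),
    [/\ cont_map A B f, cont_map B A g,
        homotopic A A (g \o f) id & homotopic B B (f \o g) id].

(* Main.v *)
(** An inclusion-maximal cell [C] whose recession cone is not a linear space
    deformation retracts onto the union of its proper faces: a point [x] is
    pushed away from a center [z x] in the relative interior of [C] that recedes
    with [x], until it meets the boundary.  Removing such cells one at a time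
    leaves a complex in which every recession cone is the lineality space of its
    cell.  Cells that meet share a nonempty common face and hence their lineality
    space, so the orthogonal projections of the cells along their lineality
    spaces fit together into a deformation retraction onto the complex of slices
    [C ∩ lin(C)^⊥].  These slices are bounded, and slices of disjoint cells stay
    disjoint because a slice is contained in its cell. *)
Require Import Defs.
From HB Require Import structures.
From mathcomp Require Import all_boot all_order all_algebra.
From mathcomp Require Import all_classical all_reals all_analysis.
From mathcomp Require Import ring lra.
Set Implicit Arguments.
Unset Strict Implicit.
Unset Printing Implicit Defensive.
Import Order.TTheory GRing.Theory Num.Theory.
Import numFieldNormedType.Exports.
Local Open Scope classical_set_scope.
Local Open Scope ring_scope.

(** * Continuity on subsets, homotopies and homotopy equivalences *)

Lemma within_continuous_comp_sub {T U V : topologicalType} (A : set T)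
    (B : set U) (f : T -> U) (g : U -> V) :
  {within A, continuous f} -> (forall x, A x -> B (f x)) ->
  {within B, continuous g} -> {within A, continuous (g \o f)}.
Proof.
move=> /subspace_continuousP cf fAB /subspace_continuousP cg.
apply/subspace_continuousP => x Ax.
apply: (@cvg_comp _ _ _ f g _ (within B (nbhs (f x)))); last exact: cg (fAB _ Ax).
move=> W BW; have : nbhs x (fun y => A y -> B (f y) -> W (f y)) := cf x Ax _ BW.
suff sub : (fun y => A y -> B (f y) -> W (f y)) `<=` (fun y => A y -> W (f y)).
  exact: filterS sub.
by move=> y ABW Ay; apply: ABW => //; exact: fAB.
Qed.

Lemma within_continuous_pair {T U V : topologicalType} (A : set T)
    (f : T -> U) (g : T -> V) :
  {within A, continuous f} -> {within A, continuous g} ->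
  {within A, continuous (fun x => (f x, g x))}.
Proof.
move=> /subspace_continuousP cf /subspace_continuousP cg.
apply/subspace_continuousP => x Ax.
by apply: cvg_pair; [exact: cf|exact: cg].
Qed.

Lemma within_continuous_fst {T U : topologicalType} (A : set (T * U)) :
  {within A, continuous fst}.
Proof. by apply: continuous_subspaceT => x; exact: cvg_fst. Qed.

Lemma within_continuous_snd {T U : topologicalType} (A : set (T * U)) :
  {within A, continuous snd}.
Proof. by apply: continuous_subspaceT => x; exact: cvg_snd. Qed.

Lemma within_continuous_sndT {T U V : topologicalType} (I : set T) (A : set U)
    (f : U -> V) :
  {within A, continuous f} -> {within I `*` A, continuous (f \o snd)}.
Proof.
by apply: within_continuous_comp_sub; [exact: within_continuous_snd|case=> t x []].
Qed.

Lemma homotopic_precomp {R : realType} {n m p : nat} (A : set 'rV[R]_n)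
    (B : set 'rV[R]_m) (C : set 'rV[R]_p) (f g : 'rV[R]_m -> 'rV[R]_p)
    (k : 'rV[R]_n -> 'rV[R]_m) :
  cont_map A B k -> homotopic B C f g -> homotopic A C (f \o k) (g \o k).
Proof.
move=> [ck kAB] [H [cH HBC H0 H1]].
exists (fun p => H (p.1, k p.2)); split.
- apply: (within_continuous_comp_sub _ _ cH) => [|[t x] [/= t01 Ax]].
    apply: within_continuous_pair; first exact: within_continuous_fst.
    exact: within_continuous_sndT.
  by split => //; exact: kAB.
- by move=> t x t01 Ax; apply: HBC => //; exact: kAB.
- by move=> x Ax; rewrite H0//; exact: kAB.
- by move=> x Ax; rewrite H1//; exact: kAB.
Qed.

Lemma homotopic_postcomp {R : realType} {n m p : nat} (A : set 'rV[R]_n)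
    (B : set 'rV[R]_m) (C : set 'rV[R]_p) (f g : 'rV[R]_n -> 'rV[R]_m)
    (k : 'rV[R]_m -> 'rV[R]_p) :
  cont_map B C k -> homotopic A B f g -> homotopic A C (k \o f) (k \o g).
Proof.
move=> [ck kBC] [H [cH HAB H0 H1]].
exists (k \o H); split.
- by apply: (within_continuous_comp_sub cH _ ck) => -[t x] [t01 Ax]; exact: HAB.
- by move=> t x t01 Ax; apply: kBC; exact: HAB.
- by move=> x Ax /=; rewrite H0.
- by move=> x Ax /=; rewrite H1.
Qed.

Lemma homotopic_trans {R : realType} {n m : nat} (A : set 'rV[R]_n)
    (B : set 'rV[R]_m) (f g h : 'rV[R]_n -> 'rV[R]_m) :
  homotopic A B f g -> homotopic A B g h -> homotopic A B f h.
Proof.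
move=> [G [cG GAB G0 G1]] [H [cH HAB H0 H1]].
pose I : set R := `[0, 1]%classic.
pose s (t : R) := Num.min (2 * t) 1; pose u (t : R) : R := Num.max (2 * t - 1) 0.
have cs : continuous s.
  move=> t; apply: continuous_min; last exact: cvg_cst.
  by apply: cvgMl_tmp; exact: cvg_id.
have cu : continuous u.
  move=> t; refine (@continuous_max R R (fun t => 2 * t - 1) (cst 0) t _ _);
    last exact: cvg_cst.
  by apply: cvgB; [apply: cvgMl_tmp; exact: cvg_id|exact: cvg_cst].
have sI t : I t -> I (s t).
  by rewrite /I /s /= !in_itv /= => /andP[t0 t1]; case: (leP (2 * t) 1) => ?; lra.
have uI t : I t -> I (u t).
  by rewrite /I /u /= !in_itv /= => /andP[t0 t1]; case: (leP (2 * t - 1) 0) => ?; lra.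
have I1 : I 1 by rewrite /I /= in_itv /= lexx ler01.
have reparam (w : R -> R) (K : R * 'rV[R]_n -> 'rV[R]_m) : continuous w ->
    (forall t, I t -> I (w t)) -> {within I `*` A, continuous K} ->
    {within I `*` A, continuous (fun p => K (w p.1, p.2))}.
  move=> cw wI cK; apply: (within_continuous_comp_sub _ _ cK).
    apply: within_continuous_pair; last exact: within_continuous_snd.
    apply: continuous_subspaceT => p; apply: (@continuous_comp _ _ _ fst w).
      exact: cvg_fst.
    exact: cw.
  by move=> [t x] [It Ax]; split => //; exact: wI.
(* Whenever one of the two homotopies moves, the other one sits at [g] and is
   cancelled by the last summand, so no pasting is needed. *)
pose F (p : R * 'rV[R]_n) : 'rV[R]_m := G (s p.1, p.2) + H (u p.1, p.2) - G (1, p.2).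
have FE t x : I t -> A x ->
    F (t, x) = if 2 * t <= 1 then G (2 * t, x) else H (2 * t - 1, x).
  move=> It Ax; rewrite /F /s /u /=; case: leP => t2.
    by rewrite max_r ?subr_le0 // H0 // G1 // addrK.
  by rewrite max_l ?subr_ge0 ?(ltW t2) // addrC addKr.
exists F; split.
- have c1 := reparam _ _ cs sI cG; have c2 := reparam _ _ cu uI cH.
  have c3 := reparam (cst 1) _ (@cst_continuous R R 1) (fun _ _ => I1) cG.
  move=> p; apply: cvgB; last exact: c3.
  by apply: cvgD; [exact: c1|exact: c2].
- move=> t x It Ax; rewrite FE //.
  move: It; rewrite /I /= in_itv /= => /andP[t0 t1].
  case: leP => t2; [apply: GAB|apply: HAB] => //=; rewrite in_itv /=; lra.
- move=> x Ax; rewrite FE //; last by rewrite /I /= in_itv /= lexx ler01.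
  by rewrite mulr0 ler01 G0.
- move=> x Ax; rewrite FE //.
  rewrite mulr1 ifF; last by apply/negbTE; rewrite -ltNge; lra.
  by rewrite -H1 //; congr (H (_, _)); ring.
Qed.

Lemma homotopy_equivalent_trans {R : realType} {n m p : nat}
    (A : set 'rV[R]_n) (B : set 'rV[R]_m) (C : set 'rV[R]_p) :
  homotopy_equivalent A B -> homotopy_equivalent B C ->
  homotopy_equivalent A C.
Proof.
have comp (a b c : nat) (X : set 'rV[R]_a) (Y : set 'rV[R]_b) (Z : set 'rV[R]_c)
    f g : cont_map X Y f -> cont_map Y Z g -> cont_map X Z (g \o f).
  move=> [cf fXY] [cg gYZ]; split; first exact: within_continuous_comp_sub cg.
  by move=> x Xx; apply: gYZ; exact: fXY.
move=> [f [g [cf cg gf fg]]] [f' [g' [cf' cg' gf' fg']]].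
exists (f' \o f), (g \o g'); split.
- exact: comp cf'.
- exact: comp cg.
- apply: homotopic_trans gf.
  exact: (homotopic_postcomp cg (homotopic_precomp cf gf')).
- apply: homotopic_trans fg'.
  exact: (homotopic_postcomp cf' (homotopic_precomp cg' fg)).
Qed.

(** The inclusion of [B] is a homotopy inverse of [r]: the straight-line homotopy from [r] to the
    identity stays in [A] by the last hypothesis, and on [B] a constant homotopy suffices. *)
Lemma homotopy_equivalent_retract {R : realType} {n : nat}
    (A B : set 'rV[R]_n) (r : 'rV[R]_n -> 'rV[R]_n) :
  B `<=` A -> {within A, continuous r} -> (forall x, A x -> B (r x)) ->
  (forall x, B x -> r x = x) ->
  (forall (t : R) x, 0 <= t <= 1 -> A x -> A ((1 - t) *: r x + t *: x)) ->
  homotopy_equivalent A B.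
Proof.
move=> BA cr rAB rB seg; exists r, id; split.
- by split.
- split; first by apply: continuous_subspaceT => x; exact: cvg_id.
  by move=> x; exact: BA.
- exists (fun p => (1 - p.1) *: r p.2 + p.1 *: p.2); split.
  + have c1 := @within_continuous_fst _ _ (`[(0 : R), 1]%classic `*` A).
    have c2 := @within_continuous_snd _ _ (`[(0 : R), 1]%classic `*` A).
    have c3 := within_continuous_sndT (I := `[(0 : R), 1]%classic) cr.
    move=> p; apply: cvgD; apply: cvgZ; [|exact: c3|exact: c1|exact: c2].
    by apply: cvgB; [exact: cvg_cst|exact: c1].
  + by move=> t x; rewrite /= in_itv /= => t01 Ax; exact: seg.
  + by move=> x Ax; rewrite subr0 scale1r scale0r addr0.
  + by move=> x Ax; rewrite subrr scale1r scale0r add0r.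
- exists snd; split.
  + exact: within_continuous_snd.
  + by [].
  + by move=> x Bx /=; rewrite rB.
  + by [].
Qed.

(** Pasting along a finite closed cover. The union is shown to be closed in the same induction,
    because each pasting step needs both pieces closed. *)
Lemma within_continuous_underlying {R : realType} {n : nat} {V : topologicalType}
    (K : seq (set 'rV[R]_n)) (f : 'rV[R]_n -> V) :
  (forall C, C \in K -> closed C) ->
  (forall C, C \in K -> {within C, continuous f}) ->
  {within underlying_space K, continuous f}.
Proof.
move=> clK cK; suff : closed (underlying_space K) /\
  {within underlying_space K, continuous f} by case.
elim: K clK cK => [|C K IH] clK cK.
  rewrite (_ : underlying_space [::] = set0).
    by split; [exact: closed0|exact: continuous_subspace0].
  by apply/seteqP; split => // x [].
have [||cl c] := IH.
- by move=> D DK; apply: clK; rewrite in_cons DK orbT.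
- by move=> D DK; apply: cK; rewrite in_cons DK orbT.
have -> : underlying_space (C :: K) = C `|` underlying_space K.
  apply/seteqP; split => x.
    by move=> [D]; rewrite in_cons => /orP[/eqP ->|DK] Dx; [left|right; exists D].
  by move=> [Cx|[D DK Dx]]; [exists C|exists D]; rewrite ?in_cons ?eqxx ?DK ?orbT.
have clC : closed C by apply: clK; rewrite mem_head.
split; first exact: closedU.
by apply: withinU_continuous => //; apply: cK; rewrite mem_head.
Qed.

(** * Finite maxima and elementary inequalities *)

(** Positivity rules out that the maximum is merely the default value 0. *)
Lemma bigmax_attained {R : realType} {I : eqType} (s : seq I) (P : pred I)
    (F : I -> R) :
  0 < \big[Num.max/0]_(i <- s | P i) F i ->
  exists i, [/\ i \in s, P i & F i = \big[Num.max/0]_(i <- s | P i) F i].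
Proof.
elim: s => [|j s IH]; first by rewrite big_nil ltxx.
have tail : 0 < \big[Num.max/0]_(i <- s | P i) F i ->
    exists i, [/\ i \in j :: s, P i & F i = \big[Num.max/0]_(i <- s | P i) F i].
  by move=> /IH[i [si Pi Fi]]; exists i; rewrite in_cons si orbT.
rewrite big_cons; case: ifP => // Pj.
set m := \big[_/_]_(i <- s | P i) F i in tail *.
by case: (leP (F j) m) => // _ _; exists j; rewrite mem_head.
Qed.

(** Serves to move a little in a given direction without violating finitely many strict
    inequalities. *)
Lemma small_multiple {R : realType} {I : eqType} (s : seq I) (f b : I -> R) :
  (forall i, i \in s -> 0 < f i) ->
  exists2 e, 0 < e & forall i, i \in s -> e * b i <= f i.
Proof.
elim: s => [|j s IH] f0; first by exists 1.
have [i si|e e0 He] := IH; first by apply: f0; rewrite in_cons si orbT.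
have fj : 0 < f j by apply: f0; rewrite mem_head.
(* Adding 1 keeps the denominator positive when [b j] is 0. *)
have bj : 0 < `|b j| + 1 by rewrite ltr_wpDl.
have d0 : 0 < f j / (`|b j| + 1) by rewrite divr_gt0.
exists (Num.min e (f j / (`|b j| + 1))); first by rewrite lt_min e0.
move=> i; rewrite in_cons => /orP[/eqP ->|si].
  apply: (@le_trans _ _ (f j / (`|b j| + 1) * (`|b j| + 1))).
    apply: (@le_trans _ _ (Num.min e (f j / (`|b j| + 1)) * (`|b j| + 1))).
      rewrite ler_wpM2l ?le_min ?(ltW e0) ?(ltW d0) //.
      by rewrite (le_trans (ler_norm _))// lerDl.
    by rewrite ler_wpM2r ?(ltW bj) // ge_min lexx orbT.
  by rewrite divfK // gt_eqF.
case: (leP 0 (b i)) => bi.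
  by rewrite (le_trans _ (He i si)) // ler_wpM2r // ge_min lexx.
rewrite (@le_trans _ _ 0) ?(ltW (f0 _ _)) ?in_cons ?si ?orbT //.
by rewrite mulr_ge0_le0 ?(ltW bi) // le_min (ltW e0) (ltW d0).
Qed.

Lemma affine_bounded_slope {R : realType} (a b c : R) :
  (forall t, 0 <= t -> a + t * b <= c) -> b <= 0.
Proof.
move=> H; rewrite leNgt; apply/negP => b0.
have H0 := H 0 (lexx _).
(* At this [t] the affine function takes the value [c + 1], beyond its bound. *)
have /H : 0 <= (c - a + 1) / b by apply: divr_ge0; lra.
rewrite divfK ?gt_eqF //; lra.
Qed.

(** * The dot product and continuity of linear maps *)

Lemma dotvDr {R : realType} {n : nat} (a x y : 'rV[R]_n) :
  dotv a (x + y) = dotv a x + dotv a y.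
Proof. by rewrite /dotv linearD mulmxDr mxE. Qed.

Lemma dotvZr {R : realType} {n : nat} (a x : 'rV[R]_n) t :
  dotv a (t *: x) = t * dotv a x.
Proof. by rewrite /dotv linearZ -scalemxAr mxE. Qed.

Lemma dotvNr {R : realType} {n : nat} (a x : 'rV[R]_n) :
  dotv a (- x) = - dotv a x.
Proof. by rewrite -scaleN1r dotvZr mulN1r. Qed.

Lemma dotvBr {R : realType} {n : nat} (a x y : 'rV[R]_n) :
  dotv a (x - y) = dotv a x - dotv a y.
Proof. by rewrite dotvDr dotvNr. Qed.

Lemma dotvC {R : realType} {n : nat} (x y : 'rV[R]_n) : dotv x y = dotv y x.
Proof. by rewrite /dotv -[x in LHS]trmxK -trmx_mul mxE. Qed.

Lemma dotv0l {R : realType} {n : nat} (x : 'rV[R]_n) : dotv 0 x = 0.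
Proof. by rewrite /dotv mul0mx mxE. Qed.

Lemma dotv_mulmx {R : realType} {n : nat} (a x : 'rV[R]_n) (P : 'M[R]_n) :
  dotv a (x *m P) = dotv (a *m P^T) x.
Proof. by rewrite /dotv trmx_mul mulmxA. Qed.

Lemma dotvv_eq0 {R : realType} {n : nat} (x : 'rV[R]_n) :
  dotv x x = 0 -> x = 0.
Proof.
rewrite /dotv mxE => /eqP; rewrite psumr_eq0; last first.
  by move=> i _; rewrite mxE -expr2 sqr_ge0.
move=> /allP x0; apply/rowP => i; have := x0 i (mem_index_enum _).
by rewrite !mxE -expr2 sqrf_eq0 => /eqP.
Qed.

Lemma dotv_continuous {R : realType} {n : nat} (a : 'rV[R]_n) :
  continuous (dotv a).
Proof.
have -> : dotv a = fun x => \sum_j a 0 j * x 0 j.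
  by apply: funext => y; rewrite /dotv mxE; apply: eq_bigr => j _; rewrite mxE.
move=> x; apply: (@cvg_big _ _ _ _ _ _ _ (nbhs x)) => [|j _].
  exact: add_continuous.
by apply: cvgMl_tmp; exact: coord_continuous.
Qed.

Lemma mulmxr_continuous {R : realType} {n : nat} (P : 'M[R]_n) :
  continuous (fun x : 'rV[R]_n => x *m P).
Proof.
have -> : (fun x : 'rV[R]_n => x *m P) = fun x => \sum_j x 0 j *: row j P.
  by apply: funext => y; rewrite mulmx_sum_row.
move=> x; apply: (@cvg_big _ _ _ _ _ _ _ (nbhs x)) => [|j _].
  exact: add_continuous.
by apply: cvgZr_tmp; exact: coord_continuous.
Qed.

(** * Polyhedra, recession cones, lineality spaces and faces *)

Lemma polyhedron_closed {R : realType} {n : nat} (C : set 'rV[R]_n) :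
  polyhedron C -> closed C.
Proof.
move=> [s ->].
have -> : [set x | forall h, h \in s -> dotv h.1 x <= h.2] =
    \bigcap_(h in [set` s]) (dotv h.1 @^-1` [set y | y <= h.2]).
  by apply/seteqP; split.
apply: closed_bigI => h _; apply: preimage_closed; last exact: closed_le.
by move=> x _; exact: dotv_continuous.
Qed.

Lemma polyhedron_segment {R : realType} {n : nat} (C : set 'rV[R]_n) x y (t : R) :
  polyhedron C -> C x -> C y -> 0 <= t <= 1 -> C ((1 - t) *: x + t *: y).
Proof.
move=> [s ->] Cx Cy /andP[t0 t1] h sh; rewrite dotvDr !dotvZr.
have := Cx h sh; have := Cy h sh; nra.
Qed.

(** For the empty set both this cone and the lineality space are the whole space, so the empty cell
    counts as having a linear recession cone. *)
Definition recession {R : realType} {n : nat} (C : set 'rV[R]_n) :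
  set 'rV[R]_n := [set v | forall x t, C x -> 0 <= t -> C (x + t *: v)].

Definition lineality {R : realType} {n : nat} (C : set 'rV[R]_n) :
  set 'rV[R]_n := [set v | forall x t, C x -> C (x + t *: v)].

(** Along one ray in [C] every defining functional is bounded above, so its slope is nonpositive;
    the ray can then start at any point of [C]. *)
Lemma ray_recession {R : realType} {n : nat} (C : set 'rV[R]_n) x v :
  polyhedron C -> (forall t, 0 <= t -> C (x + t *: v)) -> recession C v.
Proof.
move=> [s ->] ray y t Cy t0 h sh; rewrite dotvDr dotvZr.
have : dotv h.1 v <= 0.
  apply: (@affine_bounded_slope _ (dotv h.1 x) _ h.2) => u u0.
  by have := ray u u0 h sh; rewrite dotvDr dotvZr.
have := Cy h sh; nra.
Qed.

Lemma line_lineality {R : realType} {n : nat} (C : set 'rV[R]_n) x v :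
  polyhedron C -> (forall t, C (x + t *: v)) -> lineality C v.
Proof.
move=> pC line y t Cy; have [t0|t0] := leP 0 t.
  by apply: (ray_recession (x := x) pC) => // u _; exact: line.
have /(_ y (- t) Cy) : recession C (- v).
  by apply: (ray_recession (x := x) pC) => u _; rewrite scalerN -scaleNr; exact: line.
by rewrite scaleNr scalerN opprK; apply; rewrite oppr_ge0 ltW.
Qed.

Lemma face_sub {R : realType} {n : nat} (F C : set 'rV[R]_n) :
  face F C -> F `<=` C.
Proof. by move=> [_ [a [c [_ ->]]]] x []. Qed.

Lemma face_set0 {R : realType} {n : nat} (C : set 'rV[R]_n) :
  polyhedron C -> face set0 C.
Proof.
move=> pC; split=> //; exists 0, 1; split=> [x _|]; first by rewrite dotv0l ler01.
apply/esym/seteqP; split => // x [_ /=]; rewrite dotv0l => /eqP.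
by rewrite eq_sym oner_eq0.
Qed.

(** A functional bounded above on a whole line is constant on it, so a line of [C] through a point
    of [F] stays in [F]. This is why cells that meet share their lineality space. *)
Lemma face_lineality {R : realType} {n : nat} (F C : set 'rV[R]_n) :
  face F C -> F !=set0 -> lineality F = lineality C.
Proof.
move=> fF [x Fx]; have pC : polyhedron C := fF.1.
apply/seteqP; split => v vl.
  by apply: (line_lineality (x := x) pC) => t; apply: (face_sub fF); exact: vl.
move=> y t; move: fF => [_ [a [c [Cac ->]]]] [Cy /= ac].
split; first exact: vl.
rewrite /= dotvDr dotvZr ac.
have bound (u : R) : c + u * dotv a v <= c.
  by have := Cac _ (vl y u Cy); rewrite dotvDr dotvZr ac.
suff -> : dotv a v = 0 by rewrite mulr0 addr0.
have := bound 1; have := bound (-1); lra.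
Qed.

(** Used in contrapositive form: a nonlinear recession cone passes from a nonempty face to every
    cell having that face. *)
Lemma face_recession_lineality {R : realType} {n : nat} (F C : set 'rV[R]_n) :
  face F C -> F !=set0 -> recession C `<=` lineality C ->
  recession F `<=` lineality F.
Proof.
move=> fF F0 CRL v vF; rewrite (face_lineality fF F0); apply: CRL.
have [x Fx] := F0; apply: (ray_recession (x := x) fF.1) => t t0.
by apply: (face_sub fF); exact: vF.
Qed.

(** * Relative interior and retraction onto the boundary *)

(** [q] is a relative interior point, found by repeated midpoints: averaging with a point where the
    next inequality is strict makes that one strict and keeps the earlier ones strict. *)
Lemma relint_point {R : realType} {n : nat} (C : set 'rV[R]_n)
    (s : seq ('rV[R]_n * R)) :
  C !=set0 -> polyhedron C ->
  (forall x h, C x -> h \in s -> dotv h.1 x <= h.2) ->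
  exists2 q, C q & forall h, h \in s ->
    dotv h.1 q < h.2 \/ forall x, C x -> dotv h.1 x = h.2.
Proof.
move=> C0 pC; elim: s => [|h s IH] Cs; first by have [x Cx] := C0; exists x.
have [x k Cx sk|q Cq sq] := IH; first by apply: Cs => //; rewrite in_cons sk orbT.
have [tight|/existsNP[y /not_implyP[Cy hy]]] :=
    pselect (forall x, C x -> dotv h.1 x = h.2).
  by exists q => // k; rewrite in_cons => /orP[/eqP ->|/sq //]; right.
have {}hy : dotv h.1 y < h.2.
  by rewrite lt_neqAle Cs ?mem_head // andbT; exact/eqP.
have half : 0 <= (2^-1 : R) <= 1 by lra.
exists ((1 - 2^-1) *: q + 2^-1 *: y); first exact: polyhedron_segment.
move=> k; rewrite in_cons !dotvDr !dotvZr => /orP[/eqP ->|sk].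
  by left; have := Cs _ _ Cq (mem_head h s); lra.
have [kq|] := sq _ sk; last by right.
by left; have : dotv k.1 y <= k.2; [apply: Cs; rewrite // in_cons sk orbT|lra].
Qed.

(** The segment from any [y] in [C] to [q] can be prolonged a little beyond [q] inside [C]. An
    inequality valid on [C] and tight at [q] must then be tight at [y]. *)
Lemma relint_face {R : realType} {n : nat} (s : seq ('rV[R]_n * R))
    (C F : set 'rV[R]_n) q :
  C = [set x | forall h, h \in s -> dotv h.1 x <= h.2] -> C q ->
  (forall h, h \in s -> dotv h.1 q < h.2 \/ forall x, C x -> dotv h.1 x = h.2) ->
  face F C -> F q -> F = C.
Proof.
move=> CE Cq qs fF Fq; apply/seteqP; split; first exact: face_sub fF.
move: fF Fq => [_ [a [c [Cac ->]]]] [_ /= aq] y Cy; split => //=.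
pose l := [seq h <- s | dotv h.1 q < h.2].
have [|e e0 He] := @small_multiple R _ l (fun h => h.2 - dotv h.1 q)
    (fun h => dotv h.1 q - dotv h.1 y).
  by move=> h; rewrite mem_filter subr_gt0 => /andP[].
have Cqy : C (q + e *: (q - y)).
  rewrite CE => h sh; rewrite dotvDr dotvZr dotvBr.
  have [hq|hC] := qs _ sh; last by rewrite !hC // subrr mulr0 addr0.
  by rewrite -lerBrDl; apply: He; rewrite mem_filter hq.
have := Cac _ Cqy; rewrite dotvDr dotvZr dotvBr aq gerDl pmulr_rle0 // subr_le0.
by move=> cy; apply/eqP; rewrite eq_le Cac.
Qed.

(* Points of [C] are pushed away from a center [z x = q + tau v], [q] in the
   relative interior, until they hit the boundary.  With a fixed center a point
   could move along a recession direction forever (or be the center itself);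
   letting [tau] depend on [x] makes [<h0, x - z x>] a positive constant. *)
Lemma polyhedron_boundary_retract {R : realType} {n : nat} (C : set 'rV[R]_n) :
  polyhedron C -> ~ (recession C `<=` lineality C) ->
  exists r : 'rV[R]_n -> 'rV[R]_n,
    [/\ {within C, continuous r},
        (forall x, C x -> exists F, [/\ face F C, F <> C & F (r x)]) &
        (forall F x, face F C -> F <> C -> F x -> r x = x)].
Proof.
move=> pC /existsNP[v0 /not_implyP[v0rec /existsNP[x0 /existsNP[t0]]]].
move=> /not_implyP[Cx0 Cx0t0]; have [s CE] := pC.
(* If all defining functionals were constant along [v0], no translate of [x0] along [v0] could leave
   [C]; a nonconstant one decreases, since it is bounded above on a ray. *)
have [h0 sh0 h0v0] : exists2 h0, h0 \in s & dotv h0.1 v0 < 0.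
  apply: contrapT => no; apply: Cx0t0; rewrite CE => h sh.
  rewrite dotvDr dotvZr; have -> : dotv h.1 v0 = 0; last first.
    by rewrite mulr0 addr0; move: Cx0; rewrite CE; apply.
  apply/eqP; rewrite eq_le; apply/andP; split.
    apply: (@affine_bounded_slope _ (dotv h.1 x0) _ h.2) => u u0.
    by have := v0rec _ _ Cx0 u0; rewrite CE => /(_ h sh); rewrite dotvDr dotvZr.
  by rewrite leNgt; apply/negP => hv; apply: no; exists h.
pose v : 'rV[R]_n := (- dotv h0.1 v0)^-1 *: v0.
have h0v : dotv h0.1 v = -1 by rewrite dotvZr invrN mulNr mulVf // lt_eqF.
have vrec : recession C v.
  move=> x t Cx t_ge0; rewrite scalerA; apply: v0rec => //.
  by rewrite mulr_ge0 // invr_ge0 oppr_ge0 ltW.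
have sv h : h \in s -> dotv h.1 v <= 0.
  move=> sh; apply: (@affine_bounded_slope _ (dotv h.1 x0) _ h.2) => u u0.
  by have := vrec _ _ Cx0 u0; rewrite CE => /(_ h sh); rewrite dotvDr dotvZr.
have C0 : C !=set0 by exists x0.
have [|q Cq qs] := relint_point (s := s) C0 pC.
  by move=> x h; rewrite CE => Cx sh; exact: Cx.
(* [h0] cannot be tight on all of [C], since it drops by 1 from [q] to [q + v]. *)
have h0q : dotv h0.1 q < h0.2.
  have [//|h0C] := qs _ sh0; have := h0C _ (vrec q 1 Cq ler01).
  by rewrite dotvDr dotvZr h0v h0C //; lra.
pose P (h : 'rV[R]_n * R) := (h \in s) && (dotv h.1 q < h.2).
(* As [<h0, v> = -1], this choice gives [<h0, x - z x> = h0.2 + 1 - <h0, q>] for every [x]. *)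
pose tau (x : 'rV[R]_n) : R := h0.2 + 1 - dotv h0.1 x.
pose z (x : 'rV[R]_n) : 'rV[R]_n := q + tau x *: v.
have tau_ge0 x : C x -> 0 <= tau x.
  by rewrite CE => /(_ _ sh0); rewrite /tau; lra.
have Cz x : C x -> C (z x) by move=> Cx; apply: vrec => //; exact: tau_ge0.
have zP h x : C x -> P h -> 0 < h.2 - dotv h.1 (z x).
  move=> /tau_ge0 tx /andP[/sv hv hq]; rewrite /z dotvDr dotvZr; nra.
(* The share of the slack of [h] at [z x] that is consumed on the way to [x]. The maximum [g x] is
   the gauge of [x] relative to [C] with center [z x], so the ray from [z x] through [x] leaves [C]
   at parameter [1 / g x], which is the point [r x]. *)
pose ratio (x : 'rV[R]_n) (h : 'rV[R]_n * R) : R :=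
  dotv h.1 (x - z x) / (h.2 - dotv h.1 (z x)).
pose g (x : 'rV[R]_n) : R := \big[Num.max/0]_(h <- s | P h) ratio x h.
have Ph0 : P h0 by rewrite /P sh0.
have g_gt0 x : C x -> 0 < g x.
  move=> Cx; apply: (@lt_le_trans _ _ (ratio x h0)); last exact: le_bigmax_seq.
  rewrite /ratio divr_gt0 ?zP // dotvBr /z dotvDr dotvZr h0v /tau; lra.
have g_ge h x : P h -> ratio x h <= g x.
  by move=> Ph; apply: le_bigmax_seq => //; case/andP: Ph.
have ratio_le1 x h : C x -> P h -> ratio x h <= 1.
  move=> Cx Ph; rewrite /ratio ler_pdivrMr ?zP // mul1r dotvBr lerB //.
  by move: Cx; rewrite CE; apply; case/andP: Ph.
have g_le1 x : C x -> g x <= 1.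
  by move=> Cx; apply: bigmax_le => // h Ph; exact: ratio_le1.
pose r (x : 'rV[R]_n) : 'rV[R]_n := z x + (g x)^-1 *: (x - z x).
have Cr x : C x -> C (r x).
  move=> Cx; rewrite CE => h sh; rewrite /r dotvDr dotvZr.
  have [hq|hC] := qs _ sh; last by rewrite dotvBr !hC ?subrr ?mulr0 ?addr0 //; exact: Cz.
  have Ph : P h by rewrite /P sh.
  have := g_ge _ x Ph; rewrite /ratio ler_pdivrMr ?zP // => hg.
  by rewrite -lerBrDl mulrC ler_pdivrMr ?g_gt0 // mulrC.
exists r; split.
- have cz : continuous z.
    move=> x; apply: (@cvgD _ _ _ (nbhs x) _ (cst q) (fun x => tau x *: v)).
      exact: cvg_cst.
    apply: cvgZr_tmp; apply: cvgB; first exact: cvg_cst.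
    exact: dotv_continuous.
  have cd : continuous (fun x : 'rV[R]_n => x - z x).
    by move=> x; apply: (@cvgB _ _ _ (nbhs x) _ id z); [exact: cvg_id|exact: cz].
  have cg x : C x -> {for x, continuous g}.
    move=> Cx; apply: (@cvg_big _ _ _ _ _ _ _ (nbhs x)) => [|h Ph].
      exact: max_continuous.
    apply: cvgM; last apply: cvgV.
    + apply: (@continuous_comp _ _ _ (fun x : 'rV[R]_n => x - z x) (dotv h.1)).
        exact: cd.
      exact: dotv_continuous.
    + by rewrite gt_eqF // zP.
    + apply: cvgB; first exact: cvg_cst.
      apply: (@continuous_comp _ _ _ z (dotv h.1)); first exact: cz.
      exact: dotv_continuous.
  apply: continuous_in_subspaceT => x /set_mem Cx.
  apply: (@cvgD _ _ _ (nbhs x) _ z (fun y => (g y)^-1 *: (y - z y))).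
    exact: cz.
  apply: cvgZ; last exact: cd.
  by apply: cvgV; [rewrite gt_eqF // g_gt0|exact: cg].
(* An inequality attaining the gauge is tight at [r x]; being strict at [q], it cuts out a proper
   face. *)
- move=> x Cx; have [h [sh Ph hg]] := bigmax_attained (g_gt0 _ Cx).
  exists (C `&` [set y | dotv h.1 y = h.2]); split.
  + split=> //; exists h.1, h.2; split=> // y.
    by rewrite CE => /(_ h sh).
  + move=> /seteqP[_ /(_ _ Cq)[_ /= hq]]; case/andP: Ph => _.
    by rewrite hq ltxx.
  + split=> /=; first exact: Cr.
    rewrite /r dotvDr dotvZr -[g x]hg /ratio invf_div.
    rewrite divfK ?subrKC //; apply: contraTneq (g_gt0 _ Cx) => d0.
    by rewrite -[g x]hg /ratio d0 mul0r ltxx.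
- move=> F x fF FC Fx; have Cx := face_sub fF Fx.
  (* If [g x < 1], then [r x] lies strictly beyond [x] as seen from [z x]. The functional defining
     [F] is below [c] at [z x] and equal to [c] at [x], so it would exceed [c] at [r x], a point of
     [C]. *)
  suff g1 : g x = 1 by rewrite /r g1 invr1 scale1r subrKC.
  apply/eqP; rewrite eq_le g_le1 // leNgt; apply/negP => gx1.
  have gx0 := g_gt0 _ Cx.
  have Fq : ~ F q by move=> Fq; apply: FC; exact: (relint_face CE Cq qs fF Fq).
  move: fF Fx Fq => [_ [a [c [Cac ->]]]] [_ /= ax] Fq.
  have aq : dotv a q < c.
    by rewrite lt_neqAle Cac // andbT; apply/eqP => aq; apply: Fq.
  have av : dotv a v <= 0.
    apply: (@affine_bounded_slope _ (dotv a q) _ c) => u u0.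
    by have := Cac _ (vrec _ _ Cq u0); rewrite dotvDr dotvZr.
  have az : dotv a (z x) < c.
    rewrite /z dotvDr dotvZr; have := tau_ge0 _ Cx; nra.
  have := Cac _ (Cr _ Cx); rewrite /r dotvDr dotvZr dotvBr ax leNgt => /negP.
  apply; rewrite -ltrBlDl mulrC ltr_pdivlMr //.
  by rewrite gtr_pMr // subr_gt0.
Qed.

(** * Removal of a maximal cell *)

(** The candidate [D] is replaced by each new member of the list that contains it. Searching in
    [C :: K] lets the induction run without [C] belonging to [K]. *)
Lemma maximal_superset {T : Type} (K : seq (set T)) (C : set T) :
  exists D, [/\ D \in C :: K, C `<=` D &
    forall E, E \in K -> D `<=` E -> E = D].
Proof.
elim: K => [|A K [D [DK CD Dmax]]]; first by exists C; split; rewrite ?mem_head.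
have [DA|nDA] := pselect (D `<=` A).
  exists A; split; first by rewrite !in_cons eqxx orbT.
    exact: subset_trans DA.
  move=> E; rewrite in_cons => /orP[/eqP //|KE] AE; apply/seteqP; split => //.
  by rewrite (Dmax E KE) //; exact: subset_trans AE.
exists D; split => //.
  by move: DK; rewrite !in_cons => /orP[->//|->]; rewrite !orbT.
by move=> E; rewrite in_cons => /orP[/eqP ->|]; [|exact: Dmax].
Qed.

(** By maximality [C] is not a face of another cell, so the remaining cells form a complex, and each
    of them meets [C] in a proper face. The boundary retraction is the identity there, so it extends
    by the identity to all of [K]. *)
Lemma complex_collapse {R : realType} {n : nat} (K : seq (set 'rV[R]_n)) C :
  polyhedral_complex K -> C \in K ->
  (forall D, D \in K -> C `<=` D -> D = C) ->
  ~ (recession C `<=` lineality C) ->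
  polyhedral_complex (rem C K) /\
  homotopy_equivalent (underlying_space K) (underlying_space (rem C K)).
Proof.
move=> [uK pK fK iK] KC Cmax CRL.
have memE D : (D \in rem C K) = (D != C) && (D \in K) by rewrite mem_rem_uniq.
split.
  split=> [|D|D F|D E].
  - exact: rem_uniq.
  - by rewrite memE => /andP[_ /pK].
  - rewrite !memE => /andP[DC KD] fF; rewrite (fK _ _ KD fF) andbT.
    apply: contra_neq DC => FC; apply: Cmax => //.
    by rewrite -FC; exact: face_sub fF.
  - by rewrite !memE => /andP[_ KD] /andP[_ KE]; exact: iK.
have [r [cr rF rid]] := polyhedron_boundary_retract (pK _ KC) CRL.
pose rho x := if pselect (C x) then r x else x.
have rhoC x : C x -> rho x = r x by rewrite /rho; case: pselect.
have rhoD D x : D \in rem C K -> D x -> rho x = x.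
  rewrite memE => /andP[/eqP DC KD] Dx; rewrite /rho; case: pselect => // Cx.
  apply: (rid (C `&` D)) => //; first by have [] := iK _ _ KC KD.
  by move=> CDC; apply: DC; apply: Cmax => //; rewrite -CDC => y [].
apply: (homotopy_equivalent_retract (r := rho)).
- by move=> x [D]; rewrite memE => /andP[_ KD] Dx; exists D.
- apply: within_continuous_underlying => D KD; first exact: polyhedron_closed (pK _ KD).
  have [->|DC] := eqVneq D C.
    by apply: subspace_eq_continuous cr => x /set_mem Cx; exact/esym/rhoC.
  have cid : {within D, continuous (id : 'rV[R]_n -> 'rV[R]_n)}.
    by apply: continuous_subspaceT => x; exact: cvg_id.
  apply: subspace_eq_continuous cid => x /set_mem Dx.
  by apply/esym/(rhoD D) => //; rewrite memE DC.
- move=> x [D KD Dx]; have [Cx|nCx] := pselect (C x).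
    have [F [fF FC Fr]] := rF _ Cx; exists F; rewrite ?rhoC //.
    by rewrite memE (fK _ _ KC fF) andbT; exact/eqP.
  have DC : D \in rem C K by rewrite memE KD andbT; apply: contra_notN nCx => /eqP <-.
  by exists D; rewrite ?(rhoD D).
- by move=> x [D KD Dx]; exact: rhoD Dx.
- move=> t x t01 [D KD Dx]; have [Cx|nCx] := pselect (C x).
    exists C => //; apply: polyhedron_segment => //; first exact: pK.
    by rewrite rhoC //; have [F [fF _]] := rF _ Cx; exact: face_sub fF _.
  have DC : D \in rem C K by rewrite memE KD andbT; apply: contra_notN nCx => /eqP <-.
  by exists D => //; rewrite (rhoD D) // -scalerDl subrK scale1r.
Qed.

(** * Projection along the lineality space, and slices *)

(** The projection has kernel [V] and image the orthogonal complement of [V], not [V] itself; it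
    acts on row vectors from the right. *)
Definition is_orthoproj {R : realType} {n : nat} (V : set 'rV[R]_n)
    (P : 'M[R]_n) : Prop :=
  (forall x, V (x - x *m P)) /\ (forall x v, V v -> dotv v (x *m P) = 0).

Lemma orthoproj_id {R : realType} {n : nat} (V : set 'rV[R]_n) (P : 'M[R]_n) x :
  is_orthoproj V P -> (forall v, V v -> dotv v x = 0) -> x *m P = x.
Proof.
move=> [VP PV] Vx; apply/esym/eqP; rewrite -subr_eq0; apply/eqP/dotvv_eq0.
by rewrite dotvBr Vx // PV // subrr.
Qed.

(** The lineality space is the kernel [W] of the normals of [C]. Their span [U] is orthogonal to
    [W], hence meets it only in 0, and a rank count shows that [U + W] is everything; [P] projects
    onto [U] along [W]. *)
Lemma lineality_orthoproj {R : realType} {n : nat} (C : set 'rV[R]_n) :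
  polyhedron C -> C !=set0 -> exists P, is_orthoproj (lineality C) P.
Proof.
move=> [s CE] [x0 Cx0].
pose A : 'M[R]_(size s, n) := \matrix_(i < size s) (nth (0, 0) s i).1.
have rowA (i : 'I_(size s)) v :
    (v *m A^T) 0 i = dotv (nth (0, 0) s i).1 v.
  rewrite dotvC /dotv !mxE; apply: eq_bigr => j _.
  by rewrite !mxE.
have linA v : lineality C v <-> v *m A^T = 0.
  split=> [vl|vA].
    apply/rowP => i; rewrite rowA [RHS]mxE; set h := nth _ _ _.
    have bound (t : R) : dotv h.1 x0 + t * dotv h.1 v <= h.2.
      have := vl x0 t Cx0; rewrite CE => /(_ h (mem_nth _ (ltn_ord i))).
      by rewrite dotvDr dotvZr.
    apply/eqP; rewrite eq_le; apply/andP; split.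
      exact: affine_bounded_slope (fun t _ => bound t).
    rewrite -oppr_le0; apply: (@affine_bounded_slope _ (dotv h.1 x0) _ h.2) => t _.
    by rewrite mulrN -mulNr.
  move=> x t; rewrite CE => Cx h sh; rewrite dotvDr dotvZr.
  suff -> : dotv h.1 v = 0 by rewrite mulr0 addr0; exact: Cx.
  have hs : (index h s < size s)%N by rewrite index_mem.
  by have := rowA (Ordinal hs) v; rewrite vA mxE /= nth_index.
pose U := <<A>>%MS; pose W := kermx A^T.
have UW : (U :&: W)%MS = 0.
  apply/eqP; rewrite -submx0; apply/rV_subP => u; rewrite sub_capmx genmxE.
  move=> /andP[/submxP[y uE] /sub_kermxP uA]; rewrite submx0; apply/eqP/dotvv_eq0.
  by rewrite /dotv {1}uE -mulmxA -[A]trmxK -trmx_mul uA trmx0 mulmx0 mxE.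
have UWfull : row_full (U + W)%MS.
  have := mxrank_sum_cap U W; rewrite UW mxrank0 addn0 genmxE mxrank_ker mxrank_tr.
  by rewrite subnKC ?rank_leq_col // /row_full => ->.
exists (proj_mx U W); split=> [x|x v /linA vA].
  by apply/linA/sub_kermxP/proj_mx_compl_sub/submx_full.
have := proj_mx_sub U W x; rewrite genmxE => /submxP[y ->].
by rewrite dotvC /dotv -mulmxA -[A]trmxK -trmx_mul vA trmx0 mulmx0 mxE.
Qed.

(** The largest slope [f] is positive at each unit vector, which would otherwise be a recession
    direction. By compactness [f] has a positive minimum on the unit sphere, and this bounds the
    norm of the points of [C]. *)
Lemma polyhedron_bounded {R : realType} {n : nat} (C : set 'rV[R]_n) :
  polyhedron C -> recession C `<=` [set 0] -> [bounded x | x in C].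
Proof.
move=> [s CE] rec0.
pose f (v : 'rV[R]_n) : R := \big[Num.max/0]_(h <- s) dotv h.1 v.
pose S : set 'rV[R]_n := [set v | `|v| = 1].
have fS v : S v -> 0 < f v.
  move=> Sv; apply: contrapT => /negP; rewrite -leNgt => fv0.
  have /rec0 /= v0 : recession C v.
    move=> x t; rewrite CE => Cx t0 h sh; rewrite dotvDr dotvZr.
    have : dotv h.1 v <= 0
      by apply: le_trans fv0; exact: (le_bigmax_seq 0 _ xpredT (fun h => dotv h.1 v)).
    by have := Cx h sh; nra.
  by move: Sv; rewrite /S /= v0 normr0 => /eqP; rewrite eq_sym oner_eq0.
have norm_gt0 (x : 'rV[R]_n) : x != 0 -> 0 < `|x| by rewrite normr_gt0.
have Snorm (x : 'rV[R]_n) : x != 0 -> S (`|x|^-1 *: x).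
  by move=> x0; rewrite /S /= normrZ normfV normr_id mulVf // normr_eq0.
(* The sphere is empty only when 0 is the sole vector, and the bound is then trivial. *)
have [S0|/set0P/negP/negPn/eqP S0] := pselect (S !=set0); last first.
  exists 0; split=> // M M0 x _ /=; have [->|/Snorm] := eqVneq x 0.
    by rewrite normr0 ltW.
  by rewrite S0.
have cS : compact S.
  apply: bounded_closed_compact.
    by exists 1; split=> // M M1 x /= ->; exact: ltW.
  apply: (@preimage_closed _ _ (fun x : 'rV[R]_n => `|x| : R) [set y | y = 1]);
    last exact: closed_eq.
  by move=> x _; exact: norm_continuous.
have cf : {within S, continuous f}.
  apply: continuous_subspaceT => x.
  apply: (@cvg_big _ _ _ _ _ _ _ (nbhs x)) => [|h _]; first exact: max_continuous.
  exact: dotv_continuous.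
have [c /set_mem Sc cmin] := EVT_min_rV S0 cS cf.
pose M : R := \big[Num.max/0]_(h <- s) h.2.
exists (M / f c); split=> [|B MB x Cx /=]; first exact: num_real.
have M0 : 0 <= M by exact: bigmax_ge_id.
apply: le_trans (ltW MB); have [->|x0] := eqVneq x 0.
  by rewrite normr0 divr_ge0 // ltW // fS.
have := cmin _ (mem_set (Snorm _ x0)).
have [h [sh _ hf]] := bigmax_attained (fS _ (Snorm _ x0)).
rewrite -[f (_ *: _)]hf dotvZr mulrC ler_pdivlMr ?norm_gt0 // => fch.
rewrite ler_pdivlMr ?fS // mulrC (le_trans fch) //.
apply: (@le_trans _ _ h.2); last exact: (le_bigmax_seq 0 _ xpredT snd).
by move: Cx; rewrite CE; apply.
Qed.

Definition slice {R : realType} {n : nat} (C : set 'rV[R]_n) : set 'rV[R]_n :=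
  C `&` [set x | forall v, lineality C v -> dotv v x = 0].

Lemma slice_set0 {R : realType} {n : nat} : slice (@set0 'rV[R]_n) = set0.
Proof. by rewrite /slice set0I. Qed.

Lemma orthoproj_slice {R : realType} {n : nat} (C : set 'rV[R]_n) P x :
  is_orthoproj (lineality C) P -> C x -> slice C (x *m P).
Proof.
move=> [VP PV] Cx; split; last by move=> v; exact: PV.
by have := VP x x (-1) Cx; rewrite scaleN1r opprB addrC subrK.
Qed.

(** Orthogonality to the lineality space amounts to the [n] equations [x - x *m P = 0], one per
    coordinate with normal [e j], each written as two inequalities. *)
Lemma slice_polyhedron {R : realType} {n : nat} (C : set 'rV[R]_n) :
  polyhedron C -> polyhedron (slice C).
Proof.
move=> pC; have [C0|nC0] := pselect (C !=set0); last first.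
  by have /set0P/negP/negPn/eqP C0 := nC0; rewrite C0 slice_set0 -C0.
have [P PP] := lineality_orthoproj pC C0; have [s CE] := pC.
pose e (j : 'I_n) : 'rV[R]_n := \row_i (1%:M - P) i j.
have eE j x : dotv (e j) x = (x - x *m P) 0 j.
  rewrite -[x in x - _]mulmx1 -mulmxBr dotvC /dotv !mxE.
  by apply: eq_bigr => i _; rewrite !mxE.
exists (s ++ [seq (e j, 0) | j <- enum 'I_n] ++ [seq (- e j, 0) | j <- enum 'I_n]).
apply/seteqP; split => x /=.
  move=> [Cx xV] h; have xP := orthoproj_id PP xV.
  rewrite !mem_cat => /orP[|/orP[|]].
  - by move: Cx; rewrite CE; apply.
  - by move=> /mapP[j _ ->] /=; rewrite eE xP subrr mxE.
  - by move=> /mapP[j _ ->] /=; rewrite dotvC dotvNr dotvC eE xP subrr mxE oppr0.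
move=> xs; have Cx : C x by rewrite CE => h sh; apply: xs; rewrite mem_cat sh.
suff <- : x *m P = x by exact: orthoproj_slice.
apply/esym/eqP; rewrite -subr_eq0; apply/eqP/rowP => j; rewrite [RHS]mxE -eE.
apply/eqP; rewrite eq_le; apply/andP; split.
  apply: (xs (e j, 0)); rewrite !mem_cat; apply/orP; right; apply/orP; left.
  by apply/mapP; exists j; rewrite ?mem_enum.
have := xs (- e j, 0); rewrite /= dotvC dotvNr dotvC oppr_le0; apply.
rewrite !mem_cat; apply/orP; right; apply/orP; right.
by apply/mapP; exists j; rewrite ?mem_enum.
Qed.

(** A recession direction of a nonempty slice recedes in [C], so it lies in the lineality space; it
    is also orthogonal to that space, hence 0. *)
Lemma slice_bounded {R : realType} {n : nat} (C : set 'rV[R]_n) :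
  polyhedron C -> recession C `<=` lineality C -> [bounded x | x in slice C].
Proof.
move=> pC CRL; have [[x Sx]|nS0] := pselect (slice C !=set0); last first.
  have /set0P/negP/negPn/eqP -> := nS0.
  by exists 0; split=> // M _ x.
apply: polyhedron_bounded; first exact: slice_polyhedron.
move=> v vS; have vC : lineality C v.
  apply: CRL; apply: (ray_recession (x := x) pC) => t t0.
  by have [] := vS _ _ Sx t0.
have [_ /(_ v vC)] := vS _ _ Sx ler01; rewrite scale1r dotvDr.
by have [_ /(_ v vC) ->] := Sx; rewrite add0r => /dotvv_eq0.
Qed.

(** Precomposing the functional with the projection gives an inequality valid on all of [C]. It cuts
    out [G], which has the lineality space of [C] when nonempty, so that its slice is [F]. *)
Lemma face_slice {R : realType} {n : nat} (F C : set 'rV[R]_n) :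
  face F (slice C) -> polyhedron C -> exists2 G, face G C & F = slice G.
Proof.
move=> [_ [a [c [Cac ->]]]] pC; have [C0|nC0] := pselect (C !=set0); last first.
  exists set0; first exact: face_set0.
  have /set0P/negP/negPn/eqP -> := nC0.
  by rewrite slice_set0 set0I.
have [P PP] := lineality_orthoproj pC C0.
have aP x : dotv (a *m P^T) x = dotv a (x *m P) by rewrite dotv_mulmx.
pose G := C `&` [set x | dotv (a *m P^T) x = c].
have fG : face G C.
  split=> //; exists (a *m P^T), c; split=> // x Cx.
  by rewrite aP; apply: Cac; exact: orthoproj_slice.
exists G => //; apply/seteqP; split => x.
  move=> [[Cx xV] /= ax]; have xP := orthoproj_id PP xV.
  have Gx : G x by split=> //=; rewrite aP xP.
  by split=> // v; rewrite (face_lineality fG); [exact: xV|exists x].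
move=> [Gx xV]; have G0 : G !=set0 by exists x.
move: xV; rewrite /= (face_lineality fG G0) => xV; have xP := orthoproj_id PP xV.
by move: Gx => [Cx /=]; rewrite aP xP => ax; split.
Qed.

(** If the cells meet, their lineality spaces agree and the inequality cutting [C] down to [C ∩ D]
    does the same for the slices; otherwise the slices are disjoint as well. *)
Lemma slice_face {R : realType} {n : nat} (C D : set 'rV[R]_n) :
  face (C `&` D) C -> face (C `&` D) D -> face (slice C `&` slice D) (slice C).
Proof.
move=> fC fD; have pS := slice_polyhedron fC.1.
have [CD0|nCD0] := pselect (C `&` D !=set0); last first.
  have /set0P/negP/negPn/eqP CD0 := nCD0.
  rewrite (_ : slice C `&` slice D = set0); first exact: face_set0.
  by apply/seteqP; split => // x [[Cx _] [Dx _]]; rewrite -CD0.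
have linE : lineality C = lineality D.
  by rewrite -(face_lineality fC CD0) (face_lineality fD CD0).
move: fC => [_ [a [c [Cac CDE]]]].
split=> //; exists a, c; split=> [x [Cx _]|]; first exact: Cac.
apply/seteqP; split => x.
  move=> [[Cx xC] [Dx _]]; split=> //=.
  by have : (C `&` D) x by []; rewrite CDE => -[].
move=> [[Cx xC] ac]; have [_ Dx] : (C `&` D) x by rewrite CDE.
by split=> //; split=> //=; rewrite -linE.
Qed.

Lemma complex_lineality {R : realType} {n : nat} (K : seq (set 'rV[R]_n)) C D x :
  polyhedral_complex K -> C \in K -> D \in K -> C x -> D x ->
  lineality C = lineality D.
Proof.
move=> [_ _ _ iK] KC KD Cx Dx; have [fC fD] := iK _ _ KC KD.
have CD0 : C `&` D !=set0 by exists x.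
by rewrite -(face_lineality fC CD0) (face_lineality fD CD0).
Qed.

Lemma complex_slice {R : realType} {n : nat} (K : seq (set 'rV[R]_n)) :
  polyhedral_complex K ->
  (forall C, C \in K -> recession C `<=` lineality C) ->
  [/\ polyhedral_complex (undup [seq slice C | C <- K]),
      bounded_complex (undup [seq slice C | C <- K]) &
      homotopy_equivalent (underlying_space K)
        (underlying_space (undup [seq slice C | C <- K]))].
Proof.
move=> cK CRL; have [_ pK fK iK] := cK; split.
- split; first exact: undup_uniq.
  + move=> S; rewrite mem_undup => /mapP[C KC ->].
    exact: slice_polyhedron (pK _ KC).
  + move=> S F; rewrite !mem_undup => /mapP[C KC ->] fF.
    have [G fG ->] := face_slice fF (pK _ KC).
    by apply: map_f; exact: fK fG.
  + move=> S T; rewrite !mem_undup => /mapP[C KC ->] /mapP[D KD ->].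
    have [fC fD] := iK _ _ KC KD; split; first exact: slice_face.
    by rewrite setIC; apply: slice_face; rewrite setIC.
- move=> S; rewrite mem_undup => /mapP[C KC ->].
  by apply: slice_bounded; [exact: pK|exact: CRL].
pose proj (C : set 'rV[R]_n) := xget 0 (is_orthoproj (lineality C)).
have projP C x : C \in K -> C x -> is_orthoproj (lineality C) (proj C).
  move=> KC Cx; apply: xgetPex; apply: lineality_orthoproj; first exact: pK.
  by exists x.
(* The cell containing [x] is chosen arbitrarily; the choice does not matter, because cells sharing
   a point have the same lineality space and hence the same [proj]. *)
pose rho x := x *m proj (xget set0 [set C | C \in K /\ C x]).
have rhoE C x : C \in K -> C x -> rho x = x *m proj C.
  move=> KC Cx; rewrite /rho /proj.
  have [KD Dx] : [set D | D \in K /\ D x] (xget set0 [set D | D \in K /\ D x]).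
    by apply: xgetPex; exists C.
  by rewrite (complex_lineality cK KC KD Cx Dx).
have rhoS C x : C \in K -> C x -> slice C (rho x).
  by move=> KC Cx; rewrite (rhoE C) //; apply: orthoproj_slice => //; exact: projP Cx.
apply: (homotopy_equivalent_retract (r := rho)).
- by move=> x [S]; rewrite mem_undup => /mapP[C KC ->] [Cx _]; exists C.
- apply: within_continuous_underlying => C KC.
    exact: polyhedron_closed (pK _ KC).
  have c : {within C, continuous (fun x => x *m proj C)}.
    by apply: continuous_subspaceT; exact: mulmxr_continuous.
  by apply: subspace_eq_continuous c => x /set_mem Cx; exact/esym/rhoE.
- move=> x [C KC Cx]; exists (slice C); last exact: rhoS.
  by rewrite mem_undup; exact: map_f.
- move=> x [S]; rewrite mem_undup => /mapP[C KC ->] [Cx xV].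
  by rewrite (rhoE C) //; exact: orthoproj_id (projP _ _ KC Cx) xV.
- move=> t x t01 [C KC Cx]; exists C => //.
  apply: polyhedron_segment => //; first exact: pK.
  by have [] := rhoS _ _ KC Cx.
Qed.

(** * Induction on the number of cells *)

Theorem theorem4p1 (R : realType) (n : nat) (K : seq (set 'rV[R]_n)) :
  polyhedral_complex K ->
  exists (m : nat) (L : seq (set 'rV[R]_m)),
    [/\ polyhedral_complex L, bounded_complex L,
        (ncells L <= ncells K)%N &
        homotopy_equivalent (underlying_space K) (underlying_space L)].
Proof.
move=> cK; exists n; have [k] := ubnP (size K).
elim: k => // k IH in K cK *; rewrite ltnS => Kk.
have [CRL|] := pselect (forall C, C \in K -> recession C `<=` lineality C).
  have [cL bL KL] := complex_slice cK CRL.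
  exists (undup [seq slice C | C <- K]); split=> //.
  by rewrite /ncells (leq_trans (size_undup _)) // size_map.
move=> /existsNP[C /not_implyP[KC CRL]].
have [D [DK CD Dmax]] := maximal_superset K C.
have KD : D \in K by move: DK; rewrite in_cons => /orP[/eqP ->|].
(* [C] is a face of [D], and it is nonempty because its recession cone is not linear; so a linear
   recession cone of [D] would be inherited by [C]. *)
have DRL : ~ (recession D `<=` lineality D).
  move=> DRL; have [_ _ _ /(_ _ _ KC KD)] := cK.
  rewrite setIidl // => -[_ fC]; have C0 : C !=set0.
    by apply/set0P/eqP => C0; apply: CRL; rewrite C0 => v _ x t [].
  by apply: CRL; exact: face_recession_lineality fC C0 DRL.
have [cD KD'] := complex_collapse cK KD Dmax DRL.
have sD : (size (rem D K)).+1 = size K.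
  by rewrite size_rem // prednK //; case: (K) KD.
have [|L [cL bL LK KL]] := IH _ cD; first by rewrite sD.
exists L; split=> //; last exact: homotopy_equivalent_trans KL.
by rewrite (leq_trans LK) // /ncells -sD.
Qed.
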